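(* Let $n\ge 4$ be an integer and let $d$ be an integer with $1\le d\le n/2$. Then $$\mathring\mu_n(d\mid d)_d\ \ge\ \frac{2dn-d^2+d+2}{2d^2n-d^3+d^2}.$$
   Context: $\mathbb{R}^n$ and $\Lambda^2(\mathbb{R}^n)$ carry their canonical Euclidean norms. **Rational subspaces.** A linear subspace $B$ of $\mathbb{R}^n$ is rational if it has a basis of vectors with rational coordinates; $\mathfrak{R}_n(e)$ is the set of rational subspaces of $\mathbb{R}^n$ of dimension $e$. **Height.** For $B\in\mathfrak{R}_n(e)$, the Plücker coordinates of $B$ are the $\binom{n}{e}$ minors of size $e\times e$ of an $n\times e$ matrix whose columns form a basis of $B$ (well defined up to a nonzero scalar); choosing a representative $\Xi$ with integer coordinates with gcd $1$, set $H(B)=\|\Xi\|$ (Euclidean norm). **Angles.** For nonzero $X,Y\in\mathbb{R}^n$ let $\psi(X,Y)=\|X\wedge Y\|/(\|X\|\,\|Y\|)$ (sine of the angle). For subspaces $A,B$ of dimensions $d,e\ge 1$ and $t=\min(d,e)$, define $\psi_1(A,B),\dots,\psi_t(A,B)$ recursively: $\psi_1(A,B)=\min\psi(X,Y)$ over $X\in A\setminus\{0\}$, $Y\in B\setminus\{0\}$, attained at unit vectors $X_1,Y_1$; given $(X_1,Y_1),\dots,(X_j,Y_j)$, $\psi_{j+1}(A,B)=\min\psi(X,Y)$ over nonzero $X\in A$ orthogonal to $X_1,\dots,X_j$ and nonzero $Y\in B$ orthogonal to $Y_1,\dots,Y_j$, attained at unit vectors $X_{j+1},Y_{j+1}$.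 (These numbers do not depend on the choices.) **Irrationality and exponents.** Let $d,e\in\{1,\dots,n-1\}$ with $d+e\le n$ and $1\le j\le\min(d,e)$. $\mathfrak{I}_n(d,e)_j$ is the set of $d$-dimensional subspaces $A$ of $\mathbb{R}^n$ with $\dim(A\cap B)<j$ for all $B\in\mathfrak{R}_n(e)$. For $A\in\mathfrak{I}_n(d,e)_j$, $\mu_n(A\mid e)_j\in(0,+\infty]$ is the supremum of the $\beta>0$ such that $\psi_j(A,B)\le H(B)^{-\beta}$ for infinitely many $B\in\mathfrak{R}_n(e)$. Finally $\mathring\mu_n(d\mid e)_j=\inf_{A\in\mathfrak{I}_n(d,e)_j}\mu_n(A\mid e)_j$. *)

(* Defs.v *)
From HB Require Import structures.
From mathcomp Require Import all_boot all_order all_algebra.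
From mathcomp Require Import all_classical all_reals all_analysis.

Set Implicit Arguments.
Unset Strict Implicit.
Unset Printing Implicit Defensive.

Import Order.TTheory GRing.Theory Num.Theory.

Local Open Scope classical_set_scope.
Local Open Scope ring_scope.

Section EuclideanNorms.
Variables (R : realType) (n : nat).
Implicit Types X Y : 'cV[R]_n.

Definition dot X Y : R := \sum_i X i 0 * Y i 0.

(* The library norm on matrices is the sup norm. *)
Definition enorm X : R := Num.sqrt (dot X X).

(* Norm of the wedge product: its coordinates in the orthonormal basis
   e_i /\ e_k (i < k) of the exterior square are X_i Y_k - X_k Y_i. *)
Definition wedge_norm X Y : R :=
  Num.sqrt (\sum_(i < n) \sum_(k < n | (i < k)%N)
    (X i 0 * Y k 0 - X k 0 * Y i 0) ^+ 2).

Definition psi X Y : R := wedge_norm X Y / (enorm X * enorm Y).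

End EuclideanNorms.

Section RationalSubspaces.
Variables (R : realType) (n : nat).
Implicit Type B : {vspace 'cV[R]_n}.

Definition rational_vector (v : 'cV[R]_n) : Prop :=
  exists w : 'cV[rat]_n, v = map_mx ratr w.

Definition rational_subspace B : Prop :=
  exists s : seq 'cV[R]_n,
    basis_of B s /\ (forall v, v \in s -> rational_vector v).

Definition rational_subspaces (e : nat) : set {vspace 'cV[R]_n} :=
  [set B | rational_subspace B /\ \dim B = e].

End RationalSubspaces.
Arguments rational_subspaces : clear implicits.

Section Height.
Variables (R : realType) (n : nat).

Definition increasing e (f : {ffun 'I_e -> 'I_n}) : bool :=
  [forall i : 'I_e, forall k : 'I_e, (i < k)%N ==> (f i < f k)%N].

(* The e x e minors of an n x e matrix are indexed by its row selections,
   i.e. by the strictly increasing maps f : 'I_e -> 'I_n. *)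
Definition minor e (M : 'M[R]_(n, e)) (f : {ffun 'I_e -> 'I_n}) : R :=
  \det (rowsub f M).

Definition basis_matrix (B : {vspace 'cV[R]_n}) e (M : 'M[R]_(n, e)) : bool :=
  basis_of B [seq col k M | k <- enum 'I_e].

(* Only the values of Xi at strictly increasing maps are relevant. *)
Definition primitive_plucker (B : {vspace 'cV[R]_n})
    (Xi : {ffun {ffun 'I_(\dim B) -> 'I_n} -> int}) : Prop :=
  \big[gcdn/0%N]_(f | increasing f) `|Xi f|%N = 1%N /\
  exists (M : 'M[R]_(n, \dim B)) (c : R),
    [/\ basis_matrix B M, c != 0 &
        forall f, increasing f -> (Xi f)%:~R = c * minor M f].

(* A primitive representative exists when B is rational, and its values at
   increasing maps are then unique up to a common sign. *)
Definition height (B : {vspace 'cV[R]_n}) : R :=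
  let Xi := xget [ffun=> 0] (@primitive_plucker B) in
  Num.sqrt (\sum_(f | increasing f) (Xi f)%:~R ^+ 2).

End Height.

Section Angles.
Variables (R : realType) (n : nat).
Implicit Types (A B : {vspace 'cV[R]_n}) (s : seq ('cV[R]_n * 'cV[R]_n)).

(* s lists the pairs (X_1, Y_1), ..., (X_j, Y_j) already chosen. *)
Definition admissible A B s (X Y : 'cV[R]_n) : Prop :=
  [/\ X \in A, Y \in B, X != 0, Y != 0 &
      forall p, p \in s -> dot X p.1 = 0 /\ dot Y p.2 = 0].

Definition minimizing_pair A B s (p : 'cV[R]_n * 'cV[R]_n) : Prop :=
  [/\ admissible A B s p.1 p.2, enorm p.1 = 1, enorm p.2 = 1 &
      forall X Y, admissible A B s X Y -> psi p.1 p.2 <= psi X Y].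

Fixpoint principal_pairs A B (j : nat) : seq ('cV[R]_n * 'cV[R]_n) :=
  if j is k.+1 then
    let s := principal_pairs A B k in
    rcons s (xget (0, 0) (minimizing_pair A B s))
  else [::].

(* Numbered from 1; meaningful for 1 <= j <= min (\dim A) (\dim B), where the
   minima are attained and do not depend on the choices. *)
Definition psi_ (j : nat) A B : R :=
  let p := last (0, 0) (principal_pairs A B j) in psi p.1 p.2.

End Angles.

Section Exponents.
Variables (R : realType) (n : nat).

Definition irrational_subspaces (d e j : nat) : set {vspace 'cV[R]_n} :=
  [set A | \dim A = d /\
    forall B, rational_subspaces R n e B -> (\dim (A :&: B)%VS < j)%N].

Definition mu (A : {vspace 'cV[R]_n}) (e j : nat) : \bar R :=
  ereal_sup [set beta%:E | beta in [set beta : R | 0 < beta /\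
    infinite_set [set B | rational_subspaces R n e B /\
                          psi_ j A B <= height B `^ (- beta)]]].

Definition mu_ring (d e j : nat) : \bar R :=
  ereal_inf [set mu A e j | A in irrational_subspaces d e j].

End Exponents.
Arguments irrational_subspaces : clear implicits.
Arguments mu_ring : clear implicits.

(* Main.v *)
Require Import Defs.
From mathcomp Require Import all_boot all_order all_fingroup all_algebra.
From mathcomp Require Import all_classical all_reals all_analysis.
From mathcomp Require Import zify ring lra.

(** The lower bound equals [1/d + 2/(d^2 (2n - d + 1))], and it already follows
from simultaneous approximation of the affine coordinates of [A].

A [d]-dimensional subspace [A] is the column space of an [n x d] matrix [M]
having the identity as a [d x d] block ([exists_chart]); it has [d (n - d)]
remaining entries.  Dirichlet's theorem gives, for every [Q >= 1], an integer
[1 <= q <= Q ^ (d (n - d))] and an integral matrix [K] with entries within [1/Q]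
of those of [q M] ([integral_chart]).  Let [B] be the column space of [K].
- The entries of [K] are [O(q)], so its maximal minors are [O(q ^ d)].  A primitive
  integral vector divides every integral vector proportional to it, so these
  minors bound the height: [height B = O(q ^ d)] ([height_integral_basis]).
- Every [X] in [A] is at distance [O(|X| / (q Q))] from [B], and the largest
  principal angle of [A] and [B] is controlled by this distance, so
  [psi_ d A B = O(1 / (q Q))] ([psi_dim_le]).
As [q <= Q ^ (d (n - d))], every exponent [beta] with
[(d beta - 1) d (n - d) < 1] satisfies [psi_ d A B <= height B ^ (- beta)] once
[Q] is large ([mu_ge]).  The exponent of the theorem satisfies this strictly,
because [2 (n - d) < 2 n - d + 1].

Infinitely many [B] occur: the hypothesis on [A] says that [A] is not contained
in a rational [B] of dimension [d], so finitely many such [B] stay at a positive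
distance from [A] ([not_subv_separated]), whereas the [B] built above come
arbitrarily close.

The bound on the angle comes from a variational property of a minimizing pair
[(U, V)]: every [X] of [A] admissible at that step and orthogonal to [U] is
also orthogonal to [V] ([minimizing_pair_orthogonal]).  Hence any nonzero [X] in
[A] orthogonal to the first [d - 1] vectors [X_i] has an orthogonal projection
to [B] that is orthogonal to the [Y_i], and this pair competes in the last
minimum. *)

Import Order.TTheory GRing.Theory Num.Theory.
Local Open Scope ring_scope.

(** * Euclidean geometry *)

Section Euclid.
Context {R : realType} {n : nat}.
Implicit Types X Y Z : 'cV[R]_n.

Lemma dotC X Y : dot X Y = dot Y X.
Proof. by apply: eq_bigr => i _; rewrite mulrC. Qed.

Lemma dotDl X Y Z : dot (X + Y) Z = dot X Z + dot Y Z.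
Proof. by rewrite /dot -big_split; apply: eq_bigr => i _; rewrite !mxE mulrDl. Qed.

Lemma dotZl a X Y : dot (a *: X) Y = a * dot X Y.
Proof. by rewrite /dot mulr_sumr; apply: eq_bigr => i _; rewrite !mxE mulrA. Qed.

Lemma dotNl X Y : dot (- X) Y = - dot X Y.
Proof. by rewrite -scaleN1r dotZl mulN1r. Qed.

Lemma dotBl X Y Z : dot (X - Y) Z = dot X Z - dot Y Z.
Proof. by rewrite dotDl dotNl. Qed.

Lemma dotDr X Y Z : dot X (Y + Z) = dot X Y + dot X Z.
Proof. by rewrite !(dotC X) dotDl. Qed.

Lemma dotZr a X Y : dot X (a *: Y) = a * dot X Y.
Proof. by rewrite !(dotC X) dotZl. Qed.

Lemma dotBr X Y Z : dot X (Y - Z) = dot X Y - dot X Z.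
Proof. by rewrite !(dotC X) dotBl. Qed.

Lemma dot0l X : dot 0 X = 0.
Proof. by rewrite -(scale0r 0) dotZl mul0r. Qed.

Lemma dot0r X : dot X 0 = 0.
Proof. by rewrite dotC dot0l. Qed.

Lemma dot_trmx X Y : dot X Y = (X^T *m Y) 0 0.
Proof. by rewrite mxE; apply: eq_bigr => i _; rewrite mxE. Qed.

Lemma dot_ge0 X : 0 <= dot X X.
Proof. by apply: sumr_ge0 => i _; rewrite -expr2 sqr_ge0. Qed.

Lemma dot_eq0 X : (dot X X == 0) = (X == 0).
Proof.
apply/eqP/eqP => [X0|->]; last by rewrite dot0l.
apply/colP => i; rewrite mxE; apply/eqP; rewrite -sqrf_eq0 expr2; apply/eqP.
move: i isT; apply: psumr_eq0P => // i _; by rewrite -expr2 sqr_ge0.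
Qed.

Lemma dot_gt0 X : (0 < dot X X) = (X != 0).
Proof. by rewrite lt_neqAle eq_sym dot_eq0 dot_ge0 andbT. Qed.

Lemma Lagrange_identity X Y :
  wedge_norm X Y ^+ 2 = dot X X * dot Y Y - dot X Y ^+ 2.
Proof.
rewrite sqr_sqrtr; last by do 2![apply: sumr_ge0 => ? _]; rewrite sqr_ge0.
pose a i k := (X i 0 * Y k 0 - X k 0 * Y i 0) ^+ 2.
have aC i k : a i k = a k i by rewrite /a -sqrrN; congr (_ ^+ 2); ring.
have split_sum : \sum_i \sum_k a i k = (\sum_(i < n) \sum_(k < n | (i < k)%N) a i k) *+ 2.
  rewrite mulr2n.
  have -> : \sum_i \sum_k a i k = \sum_(i < n) (\sum_(k < n | (i < k)%N) a i k +
                                         \sum_(k < n | (k < i)%N) a i k).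
    apply: eq_bigr => i _; rewrite (bigID (fun k : 'I_n => (i < k)%N)) /=.
    congr (_ + _); rewrite (bigID (fun k : 'I_n => (k < i)%N)) /=.
    rewrite [X in _ + X]big1 ?addr0 => [|k].
      by apply: eq_bigl => k; case: ltngtP.
    by case: ltngtP => // /val_inj -> _; rewrite /a subrr expr0n.
  rewrite big_split /=; congr (_ + _).
  rewrite (exchange_big_dep xpredT) //=.
  by apply: eq_bigr => i _; apply: eq_bigr => k _.
have full : \sum_i \sum_k a i k = (dot X X * dot Y Y - dot X Y ^+ 2) *+ 2.
  transitivity (\sum_i \sum_k (X i 0 * X i 0 * (Y k 0 * Y k 0)
      + X k 0 * X k 0 * (Y i 0 * Y i 0)
      - (X i 0 * Y i 0 * (X k 0 * Y k 0)) *+ 2)).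
    by apply: eq_bigr => i _; apply: eq_bigr => k _; rewrite /a; ring.
  have prod (f g : 'I_n -> R) :
      \sum_i \sum_k f i * g k = (\sum_i f i) * \sum_k g k.
    by rewrite mulr_suml; apply: eq_bigr => i _; rewrite mulr_sumr.
  under eq_bigr do rewrite sumrB big_split /= sumrMnl.
  rewrite sumrB big_split /= sumrMnl !prod [X in _ + X - _]exchange_big /= prod.
  by rewrite -/(dot _ _) -/(dot Y Y) -/(dot X Y); ring.
by apply/(pmulrnI (n := 2)) => //; rewrite -full -split_sum.
Qed.

Lemma sqr_enorm X : enorm X ^+ 2 = dot X X.
Proof. by rewrite sqr_sqrtr // dot_ge0. Qed.

(** The square of the sine is one minus the square of the cosine. *)
Lemma sqr_psi X Y : X != 0 -> Y != 0 ->
  psi X Y ^+ 2 = 1 - dot X Y ^+ 2 / (dot X X * dot Y Y).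
Proof.
rewrite -!dot_gt0 => X0 Y0.
rewrite exprMn exprVn Lagrange_identity exprMn !sqr_enorm mulrBl divff //.
by rewrite mulf_neq0 // lt0r_neq0.
Qed.

Lemma psi_ge0 X Y : 0 <= psi X Y.
Proof. by rewrite divr_ge0 ?mulr_ge0 ?sqrtr_ge0. Qed.

End Euclid.

(** * Column bases and orthogonal projections *)

Section Bases.
Context {F : fieldType} {n e : nat}.
Implicit Types (M : 'M[F]_(n, e)) (B : {vspace 'cV[F]_n}).

Lemma mem_span_cols M (X : 'cV[F]_n) :
  reflect (exists v : 'cV_e, X = M *m v)
          (X \in <<[seq col k M | k <- enum 'I_e]>>%VS).
Proof.
have mulM (v : 'cV[F]_e) : M *m v = \sum_k v k 0 *: col k M.
  apply/colP => i; rewrite mxE summxE.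
  by apply: eq_bigr => k _; rewrite !mxE mulrC.
rewrite span_def big_map big_enum /=.
apply: (iffP memv_sumP) => [[vs vsP ->]|[v ->]]; last first.
  exists (fun k => v k 0 *: col k M); last exact: mulM.
  by move=> k _; rewrite memvZ ?memv_line.
have /fin_all_exists[a aP] k : exists a, vs k = a *: col k M.
  exact/vlineP/vsP.
exists (\col_k a k); rewrite mulM.
by apply: eq_bigr => k _; rewrite mxE.
Qed.

Lemma basis_colsP M B :
  basis_of B [seq col k M | k <- enum 'I_e] <->
  (forall X, X \in B <-> exists v : 'cV_e, X = M *m v) /\
  (forall v : 'cV_e, M *m v = 0 -> v = 0).
Proof.
set cs := [seq _ | _ <- _].
have size_cs : size cs = e by rewrite size_map size_enum_ord.
have imgE : <<cs>>%VS = limg (linfun (mulmx M : 'cV_e -> 'cV_n)).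
  apply/vspaceP => X; apply/mem_span_cols/memv_imgP.
    by case=> v ->; exists v; rewrite ?memvf ?lfunE.
  by case=> v _ ->; exists v; rewrite lfunE.
have free_ker : free cs <-> forall v : 'cV_e, M *m v = 0 -> v = 0.
  have dimE := limg_ker_dim (linfun (mulmx M : 'cV_e -> 'cV_n)) fullv.
  rewrite capfv -imgE dimvf /dim /= muln1 in dimE.
  have -> : free cs = (lker (linfun (mulmx M : 'cV_e -> 'cV_n)) == 0%VS).
    rewrite /free size_cs -dimv_eq0 -[RHS](eqn_add2r (\dim <<cs>>)) dimE add0n.
    exact: eq_sym.
  split=> [/lker0P inj v Mv0|inj]; first by apply: inj; rewrite !lfunE /= mulmx0.
  apply/lker0P => u v; rewrite !lfunE /= => Muv.
  by apply/eqP; rewrite -subr_eq0; apply/eqP/inj; rewrite mulmxBr Muv subrr.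
rewrite /basis_of; split=> [/andP[/eqP <- /free_ker inj]|[memB /free_ker fr]].
  by split=> // X; split=> /mem_span_cols.
rewrite fr andbT; apply/eqP/vspaceP => X.
by apply/mem_span_cols/idP => /memB.
Qed.

Lemma exists_basis_cols B : \dim B = e ->
  exists M : 'M[F]_(n, e), basis_of B [seq col k M | k <- enum 'I_e].
Proof.
move=> dimB; pose b i := (vbasis B)`_i.
pose M : 'M[F]_(n, e) := \matrix_(i, k) b k i 0; exists M.
suff -> : [seq col k M | k <- enum 'I_e] = vbasis B by exact: vbasisP.
apply: (eq_from_nth (x0 := 0)) => [|i].
  by rewrite size_map size_enum_ord size_tuple.
rewrite size_map size_enum_ord => lt_ie.
rewrite (nth_map (Ordinal lt_ie)) ?size_enum_ord //.
by apply/colP => j; rewrite !mxE /b nth_enum_ord.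
Qed.

End Bases.

Section Projection.
Context {R : realType} {n : nat}.
Implicit Types (X Y Z : 'cV[R]_n) (A B : {vspace 'cV[R]_n}).

(** For a basis matrix [W] of [B], the Gram matrix [W^T W] is invertible, since
[W^T W v = 0] forces [|W v|^2 = 0]; the projection is [W (W^T W)^-1 W^T X]. *)
Lemma orthogonal_projection B X :
  exists2 Y, Y \in B & forall Z, Z \in B -> dot (X - Y) Z = 0.
Proof.
have [W /basis_colsP[memB injW]] := exists_basis_cols B (erefl (\dim B)).
have unitG : W^T *m W \in unitmx.
  rewrite -row_free_unit -kermx_eq0 -submx0; apply/rV_subP => u /sub_kermxP uG.
  have Wu0 : W *m u^T = 0.
    apply/eqP; rewrite -dot_eq0 dot_trmx trmx_mul trmxK -!mulmxA [W^T *m _]mulmxA.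
    by rewrite [u *m _]mulmxA uG mul0mx mxE.
  by rewrite -[u]trmxK (injW _ Wu0) trmx0 sub0mx.
exists (W *m (invmx (W^T *m W) *m (W^T *m X))); first by apply/memB; eexists.
move=> _ /memB[v ->]; rewrite dotC dot_trmx trmx_mul -mulmxA mulmxBr.
rewrite [W^T *m (W *m _)]mulmxA mulKVmx // subrr mulmx0.
by rewrite mxE.
Qed.

Lemma dist_projection B X Y Z : Y \in B -> Z \in B ->
  (forall T, T \in B -> dot (X - Y) T = 0) ->
  dot (X - Y) (X - Y) <= dot (X - Z) (X - Z).
Proof.
move=> BY BZ orth.
have -> : X - Z = (X - Y) + (Y - Z) by rewrite addrA subrK.
have := orth (Y - Z) (memvB BY BZ); move: (X - Y) (Y - Z) => U V UV.
by rewrite [leRHS]dotDl !dotDr (dotC V U) UV addr0 add0r lerDl dot_ge0.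
Qed.

(** Being orthogonal to [size s] vectors imposes at most [size s] linear
conditions. *)
Lemma exists_orthogonal A (s : seq 'cV[R]_n) : (size s < \dim A)%N ->
  exists X, [/\ X \in A, X != 0 & forall Y, Y \in s -> dot X Y = 0].
Proof.
move=> lt_sA.
pose f := linfun (mulmx (\matrix_(i < size s) (s`_i)^T) : 'cV_n -> 'cV_(size s)).
have cap0 : (A :&: lker f)%VS != 0%VS.
  apply: contraL lt_sA => /eqP cap0; rewrite -leqNgt -(limg_ker_dim f A) cap0.
  by rewrite dimv0 (leq_trans (dimvS (subvf _))) // dimvf /dim /= muln1.
exists (vpick (A :&: lker f)); rewrite vpick0.
have := memv_pick (A :&: lker f); rewrite memv_cap => /andP[AX].
rewrite memv_ker lfunE /= => /eqP fX; split=> // Y /(nthP 0)[i lt_is <-].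
have /colP/(_ (Ordinal lt_is)) := fX; rewrite !mxE => sum0; rewrite -[RHS]sum0.
by apply: eq_bigr => k _; rewrite !mxE mulrC.
Qed.

End Projection.

(** * Principal angles *)

Section PrincipalAngles.
Context {R : realType} {n : nat}.
Implicit Types (X Y Z : 'cV[R]_n) (A B : {vspace 'cV[R]_n}).

(** First variation of the cosine.  With [a = <U, V>] and [b = <X, V>], moving [U]
to [a U + (b / |X|^2) X] inside [A] turns the squared cosine [a^2] into
[a^2 + b^2 / |X|^2], which minimality of the sine forbids unless [b = 0]. *)
Lemma minimizing_pair_orthogonal A B s p X :
  minimizing_pair A B s p -> X \in A ->
  (forall q, q \in s -> dot X q.1 = 0) -> dot X p.1 = 0 -> dot X p.2 = 0.
Proof.
case: p => U V [[/= AU BV U0 V0 orthUV] U1 V1 minUV] AX orthX XU.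
have [->|X0] := eqVneq X 0; first by rewrite dot0l.
have UU : dot U U = 1 by rewrite -sqr_enorm U1 expr1n.
have VV : dot V V = 1 by rewrite -sqr_enorm V1 expr1n.
have x0 : 0 < dot X X by rewrite dot_gt0.
set x := dot X X in x0; set b := dot X V; set a := dot U V.
pose X' := a *: U + (b / x) *: X; pose s' := a ^+ 2 + b ^+ 2 / x.
have X'V : dot X' V = s'.
  by rewrite dotDl !dotZl -/a -/b /s'; field; rewrite lt0r_neq0.
have X'X' : dot X' X' = s'.
  rewrite !(dotDl, dotDr, dotZl, dotZr) (dotC U X) XU UU -/x /s'.
  by field; rewrite lt0r_neq0.
have b2x : 0 <= b ^+ 2 / x by rewrite divr_ge0 ?sqr_ge0 // ltW.
suff : b ^+ 2 / x <= 0.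
  move=> le0; have : b ^+ 2 / x == 0 by rewrite eq_le le0 b2x.
  by rewrite mulf_eq0 invr_eq0 (gt_eqF x0) orbF sqrf_eq0 => /eqP.
have [X'0|X'0] := eqVneq X' 0.
  have : s' = 0 by rewrite -X'V X'0 dot0l.
  by rewrite /s' => eq0; move: (sqr_ge0 a); lra.
have : psi U V <= psi X' V.
  apply: minUV; split=> //; first by rewrite memvD ?memvZ.
  move=> q sq; have [Uq Vq] := orthUV q sq; split=> //.
  by rewrite dotDl !dotZl Uq orthX // !mulr0 addr0.
rewrite -(ler_sqr (x := psi U V)) ?nnegrE ?psi_ge0 // !sqr_psi //.
rewrite X'V X'X' UU VV !mulr1 divr1 -/a expr2 mulfK.
  by rewrite /s'; lra.
by rewrite -X'X' dot_eq0.
Qed.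

(** At each step the chosen pair either minimizes, or is the default [(0, 0)],
to which everything is orthogonal. *)
Lemma principal_pairs_orthogonal A B k X : X \in A ->
  (forall p, p \in principal_pairs A B k -> dot X p.1 = 0) ->
  forall p, p \in principal_pairs A B k -> dot X p.2 = 0.
Proof.
move=> AX; elim: k => //= k IHk orthX p.
set s := principal_pairs A B k in IHk orthX *.
have orths q : q \in s -> dot X q.1 = 0.
  by move=> sq; apply: orthX; rewrite mem_rcons inE sq orbT.
rewrite mem_rcons inE => /predU1P[-> {p}|/(IHk orths)//].
set p := xget _ _; have Xp : dot X p.1 = 0.
  by apply: orthX; rewrite mem_rcons mem_head.
move: Xp; rewrite /p; case: xgetP => [q _ qmin|_ _]; last exact: dot0r.
exact: minimizing_pair_orthogonal qmin AX orths.
Qed.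

Lemma principal_pairs_mem A B k p : p \in principal_pairs A B k -> p.2 \in B.
Proof.
elim: k => //= k IHk; rewrite mem_rcons inE => /predU1P[->|/IHk//].
by case: xgetP => [q _ [[_ Bq _ _ _] _ _ _]|_]; rewrite ?mem0v.
Qed.

Lemma size_principal_pairs A B k : size (principal_pairs A B k) = k.
Proof. by elim: k => //= k IHk; rewrite size_rcons IHk. Qed.

(** The hypothesis says that the sine of the angle between any vector of [A] and
the subspace [B] is at most [eps].  The last minimum is bounded by evaluating
[psi] at a suitable [X] of [A] and its projection [Y] to [B]; there the
orthogonality lemma makes [(X, Y)] admissible, and [eps < 1] makes [Y] nonzero. *)
Lemma psi_dim_le A B (d : nat) (eps : R) :
  (0 < d)%N -> \dim A = d -> 0 <= eps < 1 ->
  (forall X, X \in A -> exists2 Z, Z \in B &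
      dot (X - Z) (X - Z) <= eps ^+ 2 * dot X X) ->
  psi_ d A B <= eps.
Proof.
case: d => // k _ dimA /andP[eps0 eps1] close.
rewrite /psi_ /= last_rcons; case: xgetP => [p _ [_ _ _ minp]|_]; last first.
  (* The default pair has psi equal to 0 / 0 = 0. *)
  by rewrite /psi /= /enorm dot0l sqrtr0 mulr0 invr0 mulr0.
set s := principal_pairs A B k in minp.
have [|X [AX X0 orthX]] := @exists_orthogonal R n A [seq p.1 | p <- s].
  by rewrite size_map size_principal_pairs dimA.
have orthX1 q : q \in s -> dot X q.1 = 0 by move=> sq; apply/orthX/map_f.
have orthX2 := principal_pairs_orthogonal A B k X AX orthX1.
have [Y BY projY] := orthogonal_projection B X.
have [Z BZ closeZ] := close X AX.
have XX : 0 < dot X X by rewrite dot_gt0.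
have eps2 : eps ^+ 2 < 1 by rewrite expr_lt1.
have XY : dot X Y = dot Y Y by apply/eqP; rewrite -subr_eq0 -dotBl projY.
have distY : dot X X - dot Y Y <= eps ^+ 2 * dot X X.
  apply: le_trans closeZ; apply: le_trans (dist_projection _ _ _ _ BY BZ projY).
  by rewrite [leRHS]dotBr (projY Y) // subr0 dotBl (dotC Y X) XY.
have YY : 0 < dot Y Y by nra.
have Y0 : Y != 0 by rewrite -dot_gt0.
have orthZ q : q \in s -> dot X q.1 = 0 /\ dot Y q.2 = 0.
  move=> sq; split; first exact: orthX1.
  have := projY q.2 (principal_pairs_mem A B k q sq).
  by rewrite dotBl orthX2 // => /eqP; rewrite sub0r oppr_eq0 => /eqP.
apply: (le_trans (minp X Y _)); first by split.
rewrite -ler_sqr ?nnegrE ?psi_ge0 // sqr_psi // XY.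
rewrite lerBlDl -lerBlDr ler_pdivlMr ?mulr_gt0 // expr2.
by rewrite mulrA ler_pM2r //; lra.
Qed.

End PrincipalAngles.

(** * Maximal minors and height *)

Section Height.
Context {R : realType} {n e : nat}.
Implicit Types (B : {vspace 'cV[R]_n}).

Lemma exists_unit_rowsub {F : fieldType} (M : 'M[F]_(n, e)) :
  (forall v : 'cV_e, M *m v = 0 -> v = 0) ->
  exists g : {ffun 'I_e -> 'I_n}, injective g /\ rowsub g M \in unitmx.
Proof.
move=> injM; have fullM : row_full M.
  suff: row_free M^T by rewrite /row_free mxrank_tr.
  rewrite -kermx_eq0 -submx0.
  apply/rV_subP => u /sub_kermxP uM.
  have Mu0 : M *m u^T = 0 by rewrite -[M]trmxK -trmx_mul uM trmx0.
  by rewrite -[u]trmxK (injM _ Mu0) trmx0 sub0mx.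
by exists (fullrankfun fullM); split; [apply: fullrankfun_inj | apply: fullrowsub_unit].
Qed.

(** An injective row selection with nonzero determinant factors through the
increasing enumeration of its image, whose minor is then nonzero as well. *)
Lemma exists_increasing_minor (M : 'M[R]_(n, e)) :
  (forall v : 'cV_e, M *m v = 0 -> v = 0) ->
  exists2 f : {ffun 'I_e -> 'I_n}, increasing f & minor M f != 0.
Proof.
move=> /exists_unit_rowsub[g [injg]]; rewrite unitmxE unitfE => detg.
pose S := [set g i | i : 'I_e].
have size_S : size (enum S) = e by rewrite -cardE card_imset ?card_ord.
have sorted_S : sorted ltn (map val (enum S)).
  have -> : enum S = [seq x <- enum 'I_n | x \in S].
    by rewrite enumT /enum_mem; apply: eq_filter.
  have -> : [seq x <- enum 'I_n | x \in S] =
            [seq x <- enum 'I_n | val x \in map val (enum S)].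
    by apply: eq_filter => x; rewrite (mem_map val_inj) mem_enum.
  rewrite -(filter_map val (mem (map val (enum S)))) val_enum_ord.
  by rewrite sorted_filter ?iota_ltn_sorted //; apply: ltn_trans.
have memS i : g i \in enum S by rewrite mem_enum imset_f.
have lt_h i : (index (g i) (enum S) < e)%N by move: (memS i); rewrite -index_mem size_S.
pose f := [ffun i : 'I_e => nth (g i) (enum S) i].
exists f.
  apply/'forall_forallP => i k; apply/implyP => lt_ik; rewrite !ffunE.
  have lt_S (j : 'I_e) : (j < size (enum S))%N by rewrite size_S.
  have nth_S (j : 'I_e) : nth (g j) (enum S) j = nth 0%N (map val (enum S)) j :> nat.
    by rewrite (nth_map (g j)).
  rewrite !nth_S.
  by apply: (sorted_ltn_nth ltn_trans 0%N sorted_S); rewrite ?inE ?size_map.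
have gE : rowsub g M = rowsub (f \o (fun i => Ordinal (lt_h i))) M.
  by apply/matrixP => i j; rewrite !mxE /= ffunE nth_index.
move: detg; rewrite gE rowsub_comp rowsubE det_mulmx mulf_eq0 negb_or.
by case/andP.
Qed.

Lemma minor_intr (K : 'M[int]_(n, e)) f :
  minor (map_mx intr K : 'M[R]_(n, e)) f = (\det (rowsub f K))%:~R.
Proof. by rewrite /minor -map_mxsub det_map_mx. Qed.

(** Proportionality gives [x t * y s = x s * y t], so [x t] divides
[gcd_s (x s * y t)], which is [y t] up to sign. *)
Lemma primitive_proportional {T : finType} (P : pred T) (x y : T -> int) :
  \big[gcdn/0%N]_(t | P t) `|x t|%N = 1%N ->
  (forall s t, P s -> P t -> x s * y t = x t * y s) ->
  forall t, P t -> (`|x t| %| `|y t|)%N.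
Proof.
move=> gcdx prop t Pt.
rewrite -[`|y t|%N]muln1 -gcdx (big_morph _ (muln_gcdr _) (muln0 _)).
apply/dvdn_biggcdP => s Ps.
by rewrite mulnC -abszM prop // abszM dvdn_mulr.
Qed.

End Height.

(** The primitive Pluecker vector is proportional to the integral vector of maximal
minors of [K], hence divides it coordinatewise.  The existence of a primitive
vector has to be established too, by dividing those minors by their gcd:
otherwise the height would take its default value [0]. *)
Lemma height_integral_basis {R : realType} {n e : nat} (B : {vspace 'cV[R]_n})
    (K : 'M[int]_(n, e)) : \dim B = e ->
  basis_matrix B (map_mx intr K : 'M[R]_(n, e)) ->
  0 < height B /\
  height B ^+ 2 <= \sum_(f : {ffun 'I_e -> 'I_n} | increasing f)
                     minor (map_mx intr K : 'M[R]_(n, e)) f ^+ 2.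
Proof.
move=> dimB; move: K; case: e / dimB => K basisK.
have [memB injK] := (basis_colsP _ _).1 basisK.
pose N (f : {ffun 'I_(\dim B) -> 'I_n}) := \det (rowsub f K).
have primitive_exists : exists Xi, primitive_plucker (B := B) Xi.
  have [f0 incr0] := exists_increasing_minor _ injK.
  rewrite minor_intr intr_eq0 => N0.
  set G := (\big[gcdn/0%N]_(f | increasing f) `|N f|)%N.
  have dvdG f : increasing f -> (G %| `|N f|)%N by move=> If; apply: biggcdn_inf If _.
  have G0 : (0 < G)%N by apply: dvdn_gt0 (dvdG _ incr0); rewrite absz_gt0.
  have NE f : increasing f -> (N f %/ G)%Z * G = N f.
    by move=> If; rewrite divzK // dvdzE; apply: dvdG.
  exists [ffun f => (N f %/ G)%Z]; split.
    apply/eqP; rewrite -dvdn1 -(dvdn_pmul2r G0) mul1n; apply/dvdn_biggcdP => f If.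
    rewrite -(NE f If) abszM dvdn_mul //.
    by apply: (biggcdn_inf f If); rewrite ffunE.
  exists (map_mx intr K), G%:R^-1; split=> // [|f If].
    by rewrite invr_eq0 pnatr_eq0 -lt0n.
  by rewrite ffunE minor_intr -/(N f) -{2}(NE f If) intrM mulrC mulfK ?pnatr_eq0 -?lt0n.
rewrite /height; set Xi := xget _ _.
have [gcdXi [M [c [basisM c0 XiE]]]] : primitive_plucker Xi := xgetPex _ primitive_exists.
have [memM _] := (basis_colsP _ _).1 basisM.
have /fin_all_exists[v vE] k : exists v : 'cV_(\dim B), col k M = map_mx intr K *m v.
  by apply/memB/memM; exists (delta_mx k 0); rewrite colE.
pose G := \matrix_(i, k) v k i 0.
have ME : M = map_mx intr K *m G.
  apply/matrixP => i k; have /colP/(_ i) := vE k; rewrite !mxE => ->.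
  by apply: eq_bigr => l _; rewrite !mxE.
have {}XiE f : increasing f -> (Xi f)%:~R = c * \det G * (N f)%:~R :> R.
  move=> If; rewrite XiE // ME /minor -mul_rowsub_mx det_mulmx -/(minor _ f).
  by rewrite minor_intr -/(N f); ring.
have dvdXi f : increasing f -> (`|Xi f| %| `|N f|)%N.
  apply: (primitive_proportional _ Xi N gcdXi) f => f g If Ig.
  by apply: (@intr_inj R); rewrite !intrM !XiE //; ring.
have sum0 : 0 <= \sum_(f | increasing f) (Xi f)%:~R ^+ 2 :> R.
  by apply: sumr_ge0 => f _; rewrite sqr_ge0.
split.
  rewrite sqrtr_gt0 lt_neqAle sum0 andbT eq_sym; apply/eqP => /psumr_eq0P Xi0.
  move: gcdXi; rewrite big1 // => f If; apply/eqP; rewrite absz_eq0.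
  have /eqP := Xi0 (fun f _ => sqr_ge0 _) f If.
  by rewrite sqrf_eq0 intr_eq0.
rewrite sqr_sqrtr //; apply: ler_sum => f If.
have [N0|N0] := eqVneq (N f) 0.
  by rewrite XiE // minor_intr -/(N f) N0 mulr0.
rewrite minor_intr -/(N f) -[leLHS]real_normK ?num_real //.
rewrite -[leRHS]real_normK ?num_real // ler_sqr ?nnegrE // -!intr_norm ler_int.
by rewrite -!abszE lez_nat dvdn_leq ?absz_gt0 // dvdXi.
Qed.

(** * Simultaneous approximation *)

(** Pigeonhole on the [Q ^ #|T|] boxes of side [1/Q] of the unit cube, for the
fractional parts of [k * x] with [0 <= k <= Q ^ #|T|]. *)
Lemma Dirichlet_simultaneous {R : realType} {T : finType} (x : T -> R) (Q : nat) :
  (0 < Q)%N -> exists (q : nat) (p : T -> int),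
    [/\ (0 < q)%N, (q <= Q ^ #|T|)%N & forall t, `|q%:R * x t - (p t)%:~R| <= Q%:R^-1].
Proof.
case: Q => // Q _; set N := (Q.+1 ^ #|T|)%N.
have Q0 : 0 < Q.+1%:R :> R by rewrite ltr0n.
pose fr (k : nat) t : R := k%:R * x t - (Num.floor (k%:R * x t))%:~R.
have frP k t : 0 <= fr k t < 1.
  have := Num.Theory.floor_itv (k%:R * x t).
  by rewrite /fr intrD => /andP[? ?]; apply/andP; split; lra.
have tr_itv k t :
    (Num.truncn (Q.+1%:R * fr k t))%:R <= Q.+1%:R * fr k t
      < (Num.truncn (Q.+1%:R * fr k t)).+1%:R.
  by apply: Num.Theory.truncn_itv; have /andP[? ?] := frP k t; rewrite mulr_ge0 // ltW.
have tr_lt k t : (Num.truncn (Q.+1%:R * fr k t) < Q.+1)%N.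
  rewrite -(ltr_nat R); have /andP[le_tr _] := tr_itv k t.
  apply: le_lt_trans le_tr _.
  by have /andP[_ ?] := frP k t; rewrite -[ltRHS]mulr1 ltr_pM2l.
pose phi (k : 'I_N.+1) : {ffun T -> 'I_Q.+1} := [ffun t => Ordinal (tr_lt k t)].
have /injectivePn[a [b neq_ab phi_ab]] : ~~ injectiveb phi.
  apply: contraL (leqnn N.+1) => /injectiveP /leq_card.
  by rewrite card_ord card_ffun card_ord -/N ltnn.
wlog lt_ab : a b neq_ab phi_ab / (a < b)%N.
  move=> wl; have := neq_ab; rewrite -val_eqE neq_ltn => /orP[|] lt_ab.
    exact: wl lt_ab.
  by apply: wl lt_ab; rewrite // eq_sym.
exists (b - a)%N, (fun t => Num.floor (b%:R * x t) - Num.floor (a%:R * x t)).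
split=> [||t]; first by rewrite subn_gt0.
  by rewrite (leq_trans (leq_subr _ _)) // -ltnS.
have -> : (b - a)%:R * x t - (Num.floor (b%:R * x t) - Num.floor (a%:R * x t))%:~R
    = fr b t - fr a t by rewrite natrB 1?ltnW // intrB /fr; ring.
have same : Num.truncn (Q.+1%:R * fr a t) = Num.truncn (Q.+1%:R * fr b t).
  by have /ffunP/(_ t) := phi_ab; rewrite !ffunE => /(congr1 val).
have /andP[la ua] := tr_itv a t; have /andP[lb ub] := tr_itv b t.
rewrite same in la ua; rewrite -[ltRHS]natr1 in ua; rewrite -[ltRHS]natr1 in ub.
rewrite -(ler_pM2l Q0) divff ?lt0r_neq0 // -{1}(gtr0_norm Q0) -normrM ler_norml.
by rewrite mulrBr; apply/andP; split; lra.
Qed.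

Lemma det_le {R : realType} {e : nat} (A : 'M[R]_e) (b : R) :
  (forall i j, `|A i j| <= b) -> `|\det A| <= e`!%:R * b ^+ e.
Proof.
move=> Ab; apply: (le_trans (ler_norm_sum _ _ _)).
have bound (s : 'S_e) : `|(-1) ^+ s * \prod_i A i (s i)| <= b ^+ e.
  rewrite normrM normrX normrN1 expr1n mul1r normr_prod.
  rewrite -[in leRHS](card_ord e) -prodr_const.
  by apply: ler_prod => i _; rewrite normr_ge0 Ab.
apply: (le_trans (ler_sum _ (fun s _ => bound s))).
by rewrite sumr_const card_Sn mulr_natl.
Qed.

Lemma dot_mulmx_le {R : realType} {n d : nat} (E : 'M[R]_(n, d)) (v : 'cV_d)
    (eta r : R) :
  (forall i j, `|E i j| <= eta) -> (forall j, `|v j 0| <= r) ->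
  dot (E *m v) (E *m v) <= (n%:R * d%:R * eta * r) ^+ 2.
Proof.
move=> Eeta vr; set b := d%:R * eta * r.
have Ev i : ((E *m v) i 0) ^+ 2 <= b ^+ 2.
  have : `|(E *m v) i 0| <= b.
    rewrite mxE; apply: (le_trans (ler_norm_sum _ _ _)).
    have term j : true -> `|E i j * v j 0| <= eta * r.
      by move=> _; rewrite normrM ler_pM.
    apply: (le_trans (ler_sum _ term)).
    by rewrite sumr_const card_ord /b -mulrA mulr_natl.
  move=> le_b; rewrite -[leLHS]real_normK ?num_real // ler_sqr ?nnegrE //.
  exact: le_trans le_b.
apply: (le_trans (ler_sum _ (fun i _ => Ev i))).
have -> : n%:R * d%:R * eta * r = n%:R * b by rewrite /b !mulrA.
rewrite sumr_const card_ord (exprMn _ n%:R b) -[leLHS]mulr_natl ler_wpM2r ?sqr_ge0 // -natrX ler_nat.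
by case: n {E Eeta Ev} => // m; rewrite leq_pmulr.
Qed.

Lemma coord_le_enorm {R : realType} {n : nat} (X : 'cV[R]_n) i :
  `|X i 0| <= enorm X.
Proof.
rewrite -ler_sqr ?nnegrE ?sqrtr_ge0 // sqr_enorm real_normK ?num_real //.
rewrite /dot (bigD1 i) //= expr2 lerDl.
by apply: sumr_ge0 => k _; rewrite -expr2 sqr_ge0.
Qed.

Lemma exists_chart {R : realType} {n d : nat} (A : {vspace 'cV[R]_n}) :
  \dim A = d ->
  exists (g : {ffun 'I_d -> 'I_n}) (M : 'M[R]_(n, d)),
    [/\ injective g, rowsub g M = 1%:M &
        forall X, X \in A -> X = M *m rowsub g X].
Proof.
move=> dimA; have [W /basis_colsP[memA injW]] := exists_basis_cols A dimA.
have [g [injg unitg]] := exists_unit_rowsub W injW.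
exists g, (W *m invmx (rowsub g W)).
split=> // [|_ /memA[v ->]]; first by rewrite -mul_rowsub_mx mulmxV.
by rewrite -mul_rowsub_mx -mulmxA mulKmx.
Qed.

(** Dirichlet is applied to the entries outside the identity block only; the block
itself is approximated exactly by [q] times the identity.  This is what brings the
exponent of [Q] from [d n] down to [d (n - d)]. *)
Lemma integral_chart {R : realType} {n d : nat} (g : {ffun 'I_d -> 'I_n})
    (M : 'M[R]_(n, d)) (Q : nat) :
  injective g -> rowsub g M = 1%:M -> (0 < Q)%N ->
  exists (q : nat) (K : 'M[int]_(n, d)),
    [/\ (0 < q)%N, (q <= Q ^ (d * (n - d)))%N, rowsub g K = q%:R%:M &
        forall i j, `|q%:R * M i j - (K i j)%:~R| <= Q%:R^-1].
Proof.
move=> injg gM Q0; pose I := {i : 'I_n | i \notin codom g}.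
have cardI : #|{: I * 'I_d}| = (d * (n - d))%N.
  rewrite card_prod card_ord card_sig mulnC; congr (_ * _)%N.
  rewrite -[n in (n - _)%N]card_ord -[d in (_ - d)%N]card_ord -(card_codom injg).
  by rewrite -(cardC [in codom g]) addKn; apply: eq_card.
have [q [p []]] := Dirichlet_simultaneous (fun t : I * 'I_d => M (val t.1) t.2) Q Q0.
rewrite cardI => q0 qQ pP.
pose K := \matrix_(i < n, j < d)
  if insub i is Some u then p (u, j) else (q * (i == g j))%:Z.
have KE k j : K (g k) j = (q * (k == j))%:Z.
  by rewrite mxE insubF ?codom_f // (inj_eq injg).
exists q, K; split=> // [|i j].
  by apply/matrixP => k j; rewrite [LHS]mxE KE [RHS]mxE natz; case: eqP; rewrite ?muln1 ?muln0.
have [/codomP[k ->]|notg] := boolP (i \in codom g).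
  have -> : M (g k) j = (k == j)%:R.
    by have /matrixP/(_ k j) := gM; rewrite !mxE.
  by rewrite KE -pmulrn natrM subrr normr0 invr_ge0.
rewrite mxE (insubT (fun i => i \notin codom g) notg).
exact: (pP (exist _ i notg, j)).
Qed.

(** The constants [C] and [c] depend on [A] but not on [Q]. *)
Lemma good_approximations {R : realType} {n d : nat} (A : {vspace 'cV[R]_n}) :
  \dim A = d -> exists C c : R, [/\ 0 <= C, 0 <= c &
  forall Q : nat, (0 < Q)%N -> exists (B : {vspace 'cV[R]_n}) (q : nat),
    [/\ rational_subspaces R n d B,
        (0 < q <= Q ^ (d * (n - d)))%N,
        0 < height B <= c * q%:R ^+ d &
        forall X, X \in A -> exists2 Z, Z \in B &
          dot (X - Z) (X - Z) <= (C / (q%:R * Q%:R)) ^+ 2 * dot X X]].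
Proof.
move=> dimA; have [g [M [injg gM memA]]] := exists_chart A dimA.
pose m := \sum_i \sum_j `|M i j|; pose F := {ffun 'I_d -> 'I_n}.
have m0 : 0 <= m by do 2!apply: sumr_ge0 => ? _.
have Mm i j : `|M i j| <= m.
  rewrite /m (bigD1 i) //= (bigD1 j) //= -addrA lerDl addr_ge0 //.
    exact: sumr_ge0.
  by do 2!apply: sumr_ge0 => ? _.
exists (n%:R * d%:R), (#|{: F}|%:R * d`!%:R * (m + 1) ^+ d).
split=> [||Q Q0]; rewrite ?mulr_ge0 ?exprn_ge0 ?addr_ge0 //.
have [q [K [q0 qQ gK closeK]]] := integral_chart g M Q injg gM Q0.
have qR0 : 0 < q%:R :> R by rewrite ltr0n.
have QR0 : 0 < Q%:R :> R by rewrite ltr0n.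
pose K' : 'M[R]_(n, d) := map_mx intr K.
have injK (v : 'cV_d) : K' *m v = 0 -> v = 0.
  move=> Kv0; have : rowsub g (K' *m v) = 0.
    by rewrite Kv0; apply/matrixP => ? ?; rewrite !mxE.
  rewrite -mul_rowsub_mx -map_mxsub gK map_scalar_mx mul_scalar_mx.
  move/eqP; rewrite scaler_eq0 => /orP[|/eqP//].
  by rewrite /= rmorph_nat (gt_eqF qR0).
pose B := <<[seq col k K' | k <- enum 'I_d]>>%VS.
have basisK : basis_matrix B K'.
  by apply/basis_colsP; split=> // X; split=> /mem_span_cols.
have dimB : \dim B = d by have /andP[_ /eqnP ->] := basisK; rewrite size_map size_enum_ord.
exists B, q; split; last 1 first.
- move=> X AX; pose v := rowsub g X.
  exists (K' *m (q%:R^-1 *: v)); first by apply/mem_span_cols; eexists.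
  have -> : X - K' *m (q%:R^-1 *: v) = (M - q%:R^-1 *: K') *m v.
    by rewrite -scalemxAr mulmxBl -scalemxAl -memA.
  rewrite -(sqr_enorm X) -[leRHS]exprMn.
  apply: dot_mulmx_le => [i j|j]; last by rewrite mxE coord_le_enorm.
  have -> : (M - q%:R^-1 *: K') i j = q%:R^-1 * (q%:R * M i j - (K i j)%:~R).
    by rewrite !mxE mulrBr mulKf ?gt_eqF.
  by rewrite normrM gtr0_norm ?invr_gt0 // invfM ler_pM2l ?invr_gt0.
- split=> //; exists [seq col k K' | k <- enum 'I_d]; split=> // _ /mapP[k _ ->].
  exists (map_mx intr (col k K)); apply/matrixP => i j; rewrite !mxE.
  by rewrite ratr_int.
- by rewrite q0.
have [height0 height_le] := height_integral_basis B K dimB basisK.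
rewrite height0 -ler_sqr ?nnegrE; last first.
- by rewrite !mulr_ge0 ?exprn_ge0 ?addr_ge0.
- exact: ltW.
apply: (le_trans height_le).
set b := d`!%:R * ((m + 1) * q%:R) ^+ d.
have minorb (f : F) : minor K' f ^+ 2 <= b ^+ 2.
  (* [|K i j| <= q |M i j| + 1 / Q <= q (m + 1)]. *)
  have : `|minor K' f| <= b.
    apply: det_le => i j; rewrite !mxE; have := closeK (f i) j.
    have : Q%:R^-1 <= 1 :> R by rewrite invf_le1 // ler1n.
    have : 1 <= q%:R :> R by rewrite ler1n.
    have := Mm (f i) j; rewrite ler_norml ler_distl ler_norml; nra.
  move=> le_b; rewrite -[leLHS]real_normK ?num_real // ler_sqr ?nnegrE //.
  exact: le_trans le_b.
apply: (@le_trans _ _ (\sum_(f : F) b ^+ 2)).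
  rewrite [leRHS](bigID (fun f => increasing f)) /= -[leLHS]addr0 lerD //.
    by apply: ler_sum => f _.
  by apply: sumr_ge0 => f _; rewrite sqr_ge0.
have -> : #|{: F}|%:R * d`!%:R * (m + 1) ^+ d * q%:R ^+ d = #|{: F}|%:R * b.
  by rewrite /b exprMn !mulrA.
rewrite sumr_const (exprMn _ _ b) -[leLHS]mulr_natl ler_wpM2r ?sqr_ge0 //.
rewrite -natrX ler_nat; case: #|_| => // k; by rewrite leq_pmulr.
Qed.

(** * The exponent *)

(** A vector of [A] outside [B] has a positive distance to [B]; halving its square
makes the inequality strict. *)
Lemma not_subv_separated {R : realType} {n : nat} (A B : {vspace 'cV[R]_n}) :
  ~~ (A <= B)%VS -> exists2 delta : R, 0 < delta &
  exists2 X, X \in A & forall Z, Z \in B -> delta * dot X X < dot (X - Z) (X - Z).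
Proof.
case/subvPn => X AX BX; have [Y BY orthY] := orthogonal_projection B X.
have X0 : 0 < dot X X.
  by rewrite dot_gt0; apply: contraNneq BX => ->; rewrite mem0v.
have XY0 : 0 < dot (X - Y) (X - Y).
  by rewrite dot_gt0 subr_eq0; apply: contraNneq BX => ->.
exists (dot (X - Y) (X - Y) / dot X X / 2); first by rewrite !divr_gt0.
exists X => // Z BZ; apply: lt_le_trans (dist_projection _ _ _ _ BY BZ orthY).
by rewrite mulrAC divfK ?gt_eqF // ltr_pdivrMr // ltr_pMr // ltr1n.
Qed.

(** The minimum of finitely many positive bounds is positive. *)
Lemma uniform_separation {R : realType} {T : eqType} (P : R -> T -> Prop) (s : seq T) :
  (forall x y t, x <= y -> P y t -> P x t) ->
  (forall t, t \in s -> exists2 x : R, 0 < x & P x t) ->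
  exists2 x : R, 0 < x & forall t, t \in s -> P x t.
Proof.
move=> anti; elim: s => [|t s IHs] sP; first by exists 1.
have [x x0 xP] := sP t (mem_head t s).
have [y y0 yP] : exists2 x : R, 0 < x & forall t, t \in s -> P x t.
  by apply: IHs => u su; apply: sP; rewrite inE su orbT.
exists (Num.min x y) => [|u]; first by rewrite lt_min x0.
rewrite inE => /predU1P[->|/yP]; first by apply: anti xP; rewrite ge_min lexx.
by apply: anti; rewrite ge_min lexx orbT.
Qed.

Lemma powR_le_linear {R : realType} (D theta : R) : 0 <= D -> theta < 1 ->
  exists Q0 : nat, forall Q : nat, (Q0 < Q)%N -> D * Q%:R `^ theta <= Q%:R.
Proof.
move=> D0 theta1; have t0 : 0 < 1 - theta by rewrite subr_gt0.
exists (Num.truncn (D `^ (1 - theta)^-1)) => Q ltQ.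
have Q0 : 0 < Q%:R :> R by rewrite ltr0n (leq_trans _ ltQ).
have DQ : D `^ (1 - theta)^-1 <= Q%:R.
  have /andP[_ /ltW le1] := Num.Theory.truncn_itv (powR_ge0 D (1 - theta)^-1).
  by apply: (le_trans le1); rewrite ler_nat.
have QE : Q%:R = Q%:R `^ (1 - theta) * Q%:R `^ theta :> R.
  by rewrite -powRD ?subrK ?powRr1 ?ltW // (gt_eqF Q0) implybT.
rewrite [leRHS]QE ler_wpM2r ?powR_ge0 //.
have := ge0_ler_powR (ltW t0) (powR_ge0 _ _) (ltW Q0) DQ.
by rewrite -powRrM mulVf ?gt_eqF // powRr1.
Qed.

(** With [delta = d beta - 1] one has [height B ^ beta = O(q * q ^ delta)] and
[q ^ delta <= Q ^ (delta d (n - d))], where the last exponent is below [1]; so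
[C height B ^ beta <= q Q] for large [Q], that is
[C / (q Q) <= height B ^ (- beta)]. *)
Lemma mu_ge {R : realType} {n d : nat} (A : {vspace 'cV[R]_n}) (beta : R) :
  (0 < d)%N -> irrational_subspaces R n d d d A ->
  0 < beta -> 1 <= d%:R * beta -> (d%:R * beta - 1) * (d * (n - d))%:R < 1 ->
  (beta%:E <= mu A d d)%E.
Proof.
move=> d0 [dimA irrA] beta0; rewrite -subr_ge0.
set delta := d%:R * beta - 1 => delta0 thin.
apply: ereal_sup_ubound; exists beta => //; split=> //.
move/finite_seqP => [s sE].
have mem_s B :
    rational_subspaces R n d B /\ psi_ d A B <= height B `^ (- beta) <->
    B \in s.
  by have /seteqP[le1 le2] := sE; split; [apply: le1 | apply: le2].
have [C [c [C0 c0 approx]]] := good_approximations A dimA.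
have [x x0 sep] : exists2 x : R, 0 < x & forall B, B \in s ->
    exists2 X, X \in A & forall Z, Z \in B -> x * dot X X < dot (X - Z) (X - Z).
  apply: uniform_separation => [x y B xy [X AX sepX]|B /mem_s[ratB _]].
    exists X => // Z BZ; apply: le_lt_trans (sepX Z BZ).
    by rewrite ler_wpM2r ?dot_ge0.
  apply: not_subv_separated; apply: contraTN (irrA B ratB) => /capv_idPl ->.
  by rewrite dimA ltnn.
have [Q1 Q1P] := powR_le_linear (C * c `^ beta) (delta * (d * (n - d))%:R)
  (mulr_ge0 C0 (powR_ge0 _ _)) thin.
(* [Q] beyond [Q1] serves the height inequality; [Q] beyond [y] makes the
   distance to [B] smaller than both [x] and [1]. *)
pose y := C / Num.min x 1.
have m0 : 0 < Num.min x 1 by rewrite lt_min x0 ltr01.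
pose Q := (maxn Q1 (Num.truncn y)).+1.
have Q0 : 0 < Q%:R :> R by rewrite ltr0n.
have CQ : C / Q%:R < Num.min x 1.
  rewrite ltr_pdivrMr // mulrC -ltr_pdivrMr // -/y.
  have /andP[_ ltS] := Num.Theory.truncn_itv (divr_ge0 C0 (ltW m0)).
  by apply: lt_le_trans ltS _; rewrite ler_nat ltnS leq_maxr.
have [B [q [ratB /andP[q0 qQ] /andP[H0 Hq] close]]] := approx Q isT.
have qR0 : 0 < q%:R :> R by rewrite ltr0n.
set eps := C / (q%:R * Q%:R) in close.
have eps0 : 0 <= eps by rewrite divr_ge0 // mulr_ge0 // ltW.
have epsQ : eps <= C / Q%:R.
  by rewrite ler_wpM2l // lef_pV2 ?posrE ?mulr_gt0 // ler_pMl // ler1n.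
have epsm : eps < Num.min x 1 := le_lt_trans epsQ CQ.
have [epsx eps1] : eps < x /\ eps < 1 by apply/andP; rewrite -lt_min.
have epsx2 : eps ^+ 2 <= x by rewrite expr2; nra.
have Bs : B \in s.
  apply/mem_s; split=> //; apply: (@le_trans _ _ eps).
    by apply: psi_dim_le close; rewrite ?eps0.
  rewrite powRN /eps ler_pdivrMr ?mulr_gt0 // mulrC ler_pdivlMr ?powR_gt0 //.
  have le1 : height B `^ beta <= c `^ beta * (q%:R * q%:R `^ delta).
    have -> : q%:R * q%:R `^ delta = (q%:R ^+ d) `^ beta :> R.
      rewrite -powR_mulrn ?ler0n // -powRrM -{1}[q%:R]powRr1 ?ler0n //.
      by rewrite -powRD ?(gt_eqF qR0) ?implybT // /delta addrC subrK.
    rewrite -powRM ?exprn_ge0 ?(ltW qR0) //.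
    by apply: ge0_ler_powR => //; rewrite ?nnegrE ?mulr_ge0 ?exprn_ge0 // ltW.
  have le2 : q%:R `^ delta <= Q%:R `^ (delta * (d * (n - d))%:R).
    rewrite mulrC powRrM powR_mulrn ?ler0n // -natrX.
    by apply: ge0_ler_powR; rewrite ?nnegrE // ler_nat.
  apply: (le_trans (ler_wpM2l C0 le1)); rewrite [leLHS](_ : _ =
    q%:R * (C * c `^ beta * q%:R `^ delta)); last by ring.
  rewrite ler_pM2l //; apply: le_trans (Q1P Q _); last by rewrite ltnS leq_maxl.
  by rewrite ler_wpM2l // mulr_ge0 ?powR_ge0.
have [X AX sepX] := sep B Bs.
have [Z BZ closeZ] := close X AX.
have := lt_le_trans (sepX Z BZ) closeZ; rewrite ltNge ler_wpM2r ?dot_ge0 //.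
Qed.

Theorem mainTheorem5 (R : realType) (n d : nat)
    (hn : (4 <= n)%N) (hd1 : (1 <= d)%N) (hd2 : (2 * d <= n)%N) :
  (((2 * d%:R * n%:R - d%:R ^+ 2 + d%:R + 2) /
    (2 * d%:R ^+ 2 * n%:R - d%:R ^+ 3 + d%:R ^+ 2) : R)%:E
   <= mu_ring R n d d d)%E.
Proof.
set beta := (X in (X%:E <= _)%E).
have d1 : 1 <= d%:R :> R by rewrite ler1n.
have d2n : 2 * d%:R <= n%:R :> R by rewrite -natrM ler_nat.
have e0 : 0 < 2 * n%:R - d%:R + 1 :> R by lra.
have dbeta : d%:R * beta = 1 + 2 / (d%:R * (2 * n%:R - d%:R + 1)).
  rewrite /beta; field; rewrite !gt_eqF //; nra.
apply: le_ereal_inf_tmp => _ [A irrA <-]; apply: mu_ge => //.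
- rewrite -(pmulr_rgt0 _ (lt_le_trans ltr01 d1)) dbeta ltr_wpDr //.
  by rewrite divr_ge0 ?mulr_ge0; lra.
- by rewrite dbeta lerDl divr_ge0 // mulr_ge0 //; lra.
- rewrite dbeta addrAC subrr add0r natrM natrB; last by lia.
  rewrite mulrAC ltr_pdivrMr; nra.
Qed.
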